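(* There is a constant $c$ such that for any linear operator $T:l_\infty^N\to Y$, where $Y$ is a Banach space, the (Rademacher) cotype $2$ constant of $T$ is bounded according to the relation $$ K^{(2)}(T)\le c\,\log\log N\;\pi_{2,1}(T). $$
   Context: The constant $c$ is universal (independent of $N$, $Y$ and $T$). Logarithms are to base $2$. $l_\infty^N$ is the $N$-dimensional space of scalar sequences with the supremum norm. Let $\varepsilon_1,\varepsilon_2,\ldots$ be independent Rademacher random variables: $\Pr(\varepsilon_s=1)=\Pr(\varepsilon_s=-1)=\frac12$. For a linear operator $T:X\to Y$ between Banach spaces, the (Rademacher) cotype $2$ constant $K^{(2)}(T)$ is the smallest $C$ such that for every finite family $x_1,\ldots,x_S\in X$ (any $S$) $$\Big(\sum_{s=1}^S\|T(x_s)\|^2\Big)^{1/2}\le C\,\mathbb{E}\Big\|\sum_{s=1}^S\varepsilon_s x_s\Big\|.$$ The $(2,1)$-summing norm $\pi_{2,1}(T)$ is the smallest $C$ such that for every finite family $x_1,\ldots,x_S\in X$ $$\Big(\sum_{s=1}^S\|T(x_s)\|^2\Big)^{1/2}\le C\,\sup\Big\{\sum_{s=1}^S|\langle x^*,x_s\rangle|\Big\},$$ the supremum being over all $x^*$ in the unit ball of $X^*$.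
   Formalization: The formal theorem assumes N ≥ 3: for N = 1, log log N is undefined, and for N = 2 it equals 0, so the claimed bound fails for any nonzero T (for example the identity of l_∞^2). *)

(* Defs.v *)
From HB Require Import structures.
From mathcomp Require Import all_boot all_order all_algebra complex.
From mathcomp Require Import all_classical all_reals all_analysis.
Import Order.TTheory GRing.Theory Num.Theory.
Import numFieldNormedType.Exports.

Set Implicit Arguments.
Unset Strict Implicit.
Unset Printing Implicit Defensive.

Local Open Scope classical_set_scope.
Local Open Scope ring_scope.

Definition log2 (R : realType) (x : R) : R := ln x / ln 2.

(* The probability space {-1, 1}^S with the uniform measure, -1 being encoded
   as true. Its coordinates [rademacher s] are S independent Rademacher random
   variables (see [expectation_rademacher] below). *)
Definition signs (S : nat) : finType := {ffun 'I_S -> bool}.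

(* The signs are taken in the scalar field K of the space they act on. *)
Definition rademacher (K : pzRingType) (S : nat) (s : 'I_S) (w : signs S) : K :=
  (-1) ^+ w s.

Definition expectation (R : realType) (S : nat) (f : signs S -> R) : R :=
  (\sum_(w : signs S) f w) / #|signs S|%:R.

(* Independence and distribution of the coordinates. *)
Lemma expectation_rademacher (R : realType) (S : nat) (f : 'I_S -> R -> R) :
  expectation (fun w : signs S => \prod_s f s (rademacher R s w)) =
  \prod_s ((f s 1 + f s (-1)) / 2).
Proof.
rewrite /expectation /rademacher card_ffun card_bool card_ord big_split /=.
rewrite prodr_const card_ord exprVn natrX; congr (_ / _).
rewrite -(bigA_distr_bigA (fun s (b : bool) => f s ((-1) ^+ b))).
by apply: eq_bigr => s _; rewrite big_bool /= expr1 expr0 addrC.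
Qed.

(* [l_infty K N] carries the library's norm on matrices, which is the maximum
   of the absolute values of the entries. *)
Notation l_infty K N := 'rV[K]_N.

(* The scalar field K is either R, with [re := id], or R[i], with
   [re := @complex.Re R]. The library's norms on K-normed spaces take their
   values in K, and [re] reads these values back as elements of R. *)
Section SummingConstants.
Variables (R : realType) (K : numFieldType) (re : K -> R).

Definition rnorm (V : normedModType K) (v : V) : R := re `|v|.

(* Unit ball of the dual X^*, consisting of linear functionals. *)
Definition dual_unit_ball (X : normedModType K) : set {linear X -> K^o} :=
  [set f | forall x : X, `|f x| <= `|x|].

Definition weak_l1_norm (X : normedModType K) (S : nat) (x : 'I_S -> X) :
    \bar R :=
  ereal_sup [set (\sum_s re `|xs (x s)|)%:E | xs in @dual_unit_ball X].

Variables (X Y : normedModType K) (T : X -> Y).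

Definition l2_norm_image (S : nat) (x : 'I_S -> X) : R :=
  Num.sqrt (\sum_s rnorm (T (x s)) ^+ 2).

Definition cotype2_bound (C : R) : Prop :=
  forall (S : nat) (x : 'I_S -> X),
    l2_norm_image x <=
    C * expectation (fun w => rnorm (\sum_s rademacher K s w *: x s)).

Definition summing21_bound (C : R) : Prop :=
  forall (S : nat) (x : 'I_S -> X),
    ((l2_norm_image x)%:E <= C%:E * weak_l1_norm x)%E.

(* The smallest admissible constants, equal to +oo if there are none. The
   condition 0 <= C only matters when X is trivial: every real C would then be
   admissible. *)
Definition cotype2 : \bar R :=
  ereal_inf [set C%:E | C in [set C : R | 0 <= C /\ cotype2_bound C]].

Definition summing21 : \bar R :=
  ereal_inf [set C%:E | C in [set C : R | 0 <= C /\ summing21_bound C]].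

End SummingConstants.

(* Main.v *)
Require Import Defs.
From HB Require Import structures.
From mathcomp Require Import all_boot all_order all_algebra complex.
From mathcomp Require Import all_classical all_reals all_analysis.
From mathcomp Require Import ring lra zify.
Import Order.TTheory GRing.Theory Num.Theory.
Import numFieldNormedType.Exports.
Local Open Scope ring_scope.
Local Open Scope complex_scope.

Set Implicit Arguments.
Unset Strict Implicit.
Unset Printing Implicit Defensive.

(** Splitting complex sequences into real and imaginary parts reduces the
    theorem to real ones, and then the operator only matters through the
    seminorm [q f = ||T f||] on real functions [f] on the [N] coordinates.
    Normalise so that [T] has (2,1)-summing norm at most [1] and the family
    [x_s] satisfies [E ||sum_s eps_s x_s|| <= 1]; put [b_s = q x_s]. The claim
    is that [sum_s b_s^2 <= (40 m)^2], where [m] is the least integer with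
    [N <= 2^(2^m)], which is at most [3 log log N].

    What summing gives. If [|z_k| <= a_k] and [sum_k a_k |z_k(t)| <= B] for
    every coordinate [t], then [sum_k q(z_k)^2 <= 2 B]
    ([sum_sqr_seminorm_le]). Hence a piece of the family on which [|x_s(t)|]
    stays within a factor [2] of a number depending on [s] only, and on which
    [sum_s x_s(t)^2 <= D], contributes at most [4 D] ([dyadic_cuts]); and by
    Khintchine's inequality [sum_s x_s(t)^2 <= 4] everywhere. There are too many
    dyadic pieces for this alone, about [log N] of them. They are grouped into
    [O(m)] classes, each contributing [O(1)], so that the triangle inequality
    in [l_2] loses only the factor [O(m)]:
    - the values between [2^-m] and [2] form [m + 1] dyadic layers;
    - the values below [2^-m] and below [2 b_s] form one class,
      whose contribution also involves [sum_s b_s^2], with a factor small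
      enough to be absorbed ([bottom_le]);
    - the values below [2^-m] and between [2^n b_s] and [4^n b_s] form a block
      of [n] dyadic pieces, one block for each [n = 2^mu] with [mu < m].

    What the average norm gives. Cauchy-Schwarz over the [n] pieces of a block
    costs a factor [n], so a block is harmless if
    [sum_s x_s(t)^2 = O(1/n)] over the entries that lie in it ([block_le]).
    This holds after the removal of a few indices [s] ([block_light]). Select
    greedily points [t_1, t_2, ...] at which the entries in the block, of
    indices not used by an earlier point, have square sum at least [26/n].
    Were [2^n] points to be found, the disjoint sets of indices that they use
    would carry nearly independent Rademacher sums of [n] groups of comparable
    size; with [2^n] attempts, the [n] groups of some point often have the same
    sign, and the norm would be too large on average ([no_full_selection]).
    This is where [|x_s(t)| <= 1/n] is needed, to form equal groups. So fewer
    than [2^n] points exhaust the block, and since [b_s < 2^-n |x_s(t_i)|] for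
    the indices used, these have
    [sum b_s^2 <= 2^n * 4^-n * 4 = 4 * 2^-n]: they may be discarded.
    The indices with [|x_s(t)| > N b_s] for some [t] are discarded as well, so
    the blocks reach all the remaining values. *)

(** * Averages over signs and Khintchine inequality *)

Section SignAverages.
Context {R : realType}.

(** Over sign patterns indexed by ['I_S] this is convertible to the expectation of
    the Rademacher variables; other finite sample spaces also occur below. *)
Definition mean (Omega : finType) (f : Omega -> R) : R :=
  (\sum_w f w) / #|Omega|%:R.

Lemma eq_mean (Omega : finType) (f g : Omega -> R) :
  f =1 g -> mean f = mean g.
Proof. by move=> fg; rewrite /mean (eq_bigr g). Qed.

Lemma mean_cst (Omega : finType) (a : R) :
  (0 < #|Omega|)%N -> mean (fun _ : Omega => a) = a.
Proof.
move=> Omega0; rewrite /mean sumr_const -[a *+ _]mulr_natr mulfK//.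
by rewrite pnatr_eq0 -lt0n.
Qed.

Lemma meanD (Omega : finType) (f g : Omega -> R) :
  mean (fun w => f w + g w) = mean f + mean g.
Proof. by rewrite /mean big_split mulrDl. Qed.

Lemma meanZ (Omega : finType) (a : R) (f : Omega -> R) :
  mean (fun w => a * f w) = a * mean f.
Proof. by rewrite /mean -big_distrr mulrA. Qed.

Lemma mean_sum (Omega : finType) I (r : seq I) (P : pred I) (f : I -> Omega -> R) :
  mean (fun w => \sum_(i <- r | P i) f i w) = \sum_(i <- r | P i) mean (f i).
Proof. by rewrite /mean exchange_big mulr_suml. Qed.

Lemma le_mean (Omega : finType) (f g : Omega -> R) :
  (forall w, f w <= g w) -> mean f <= mean g.
Proof. by move=> fg; rewrite ler_wpM2r ?invr_ge0//; exact: ler_sum. Qed.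

Lemma mean_ge0 (Omega : finType) (f : Omega -> R) :
  (forall w, 0 <= f w) -> 0 <= mean f.
Proof. by move=> f0; rewrite mulr_ge0 ?invr_ge0// sumr_ge0. Qed.

Lemma exchange_mean (Omega Omega' : finType) (f : Omega -> Omega' -> R) :
  mean (fun w => mean (f w)) = mean (fun w' => mean (f^~ w')).
Proof. by rewrite /mean -!mulr_suml exchange_big mulrAC. Qed.

Lemma mean_bij (Omega : finType) (h : Omega -> Omega) (f : Omega -> R) :
  bijective h -> mean (fun w => f (h w)) = mean f.
Proof. by move=> hb; rewrite /mean [in RHS](reindex h)//; exact: onW_bij. Qed.

Variable J : finType.
Implicit Types (m : J -> bool) (w : {ffun J -> bool}).

Lemma card_signs_gt0 : (0 < #|{ffun J -> bool}|)%N.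
Proof. by apply/card_gt0P; exists [ffun=> false]. Qed.

(** Multiplication of the signs by the signs [m]; it preserves the uniform measure,
    even when [m] is itself random and independent of [w]. *)
Definition twist m w : {ffun J -> bool} := [ffun s => m s (+) w s].

Lemma twistK m : involutive (twist m).
Proof. by move=> w; apply/ffunP => s; rewrite !ffunE addbA addbb. Qed.

Lemma mean_twist m (f : {ffun J -> bool} -> R) :
  mean (fun w => f (twist m w)) = mean f.
Proof. exact/mean_bij/inv_bij/twistK. Qed.

Lemma signr_twist m w s :
  (-1) ^+ twist m w s = (-1) ^+ m s * (-1) ^+ w s :> R.
Proof. by rewrite ffunE signr_addb. Qed.

(** Conditioning on all the signs except the one at [s]. *)
Lemma mean_flip (s : J) (f : {ffun J -> bool} -> R) :
  mean f = mean (fun w => (f w + f (twist (pred1 s) w)) / 2).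
Proof.
under [RHS]eq_mean do rewrite mulrC.
by rewrite meanZ meanD mean_twist; field.
Qed.

(** Only the even powers of a single sign survive averaging, so adding [y] to a sum
    [Z] turns its fourth moment into [E Z^4 + 6 y^2 E Z^2 + y^4], which
    preserves the bound by [3 (E Z^2)^2]. *)
Lemma khintchine_moments (r : seq J) (y : J -> R) : uniq r ->
  mean (fun w => (\sum_(s <- r) (-1) ^+ w s * y s) ^+ 2) = \sum_(s <- r) y s ^+ 2
  /\ mean (fun w => (\sum_(s <- r) (-1) ^+ w s * y s) ^+ 4)
     <= 3 * (\sum_(s <- r) y s ^+ 2) ^+ 2.
Proof.
elim: r => [_|s r IH /= /andP[sr ur]].
  under eq_mean do rewrite big_nil expr0n/=.
  under [X in _ /\ X <= _]eq_mean do rewrite big_nil expr0n/=.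
  by rewrite !mean_cst ?card_signs_gt0// big_nil expr0n mulr0.
have [IH2 IH4] := IH ur.
set Z := fun w => \sum_(s <- r) (-1) ^+ w s * y s in IH2 IH4 *.
have Zf w : Z (twist (pred1 s) w) = Z w.
  apply: eq_big_seq => s' s'r; rewrite signr_twist/=.
  by case: eqP => [e|_]; [rewrite -e s'r in sr|rewrite mul1r].
have e2 w : ((-1) ^+ w s) ^+ 2 = 1 :> R by rewrite sqrr_sign.
rewrite big_cons; split.
  rewrite (mean_flip s).
  under eq_mean => w.
    rewrite !big_cons -/(Z w) -/(Z _) Zf signr_twist/= eqxx.
    rewrite (_ : _ / 2 = Z w ^+ 2 + y s ^+ 2); first over.
    by case: (w s); rewrite ?expr1 ?expr0; field.
  by rewrite meanD IH2 mean_cst ?card_signs_gt0// addrC.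
rewrite (mean_flip s).
under eq_mean => w.
  rewrite !big_cons -/(Z w) -/(Z _) Zf signr_twist/= eqxx.
  rewrite (_ : _ / 2 = Z w ^+ 4 + (6 * y s ^+ 2 * Z w ^+ 2 + y s ^+ 4)); first over.
  by case: (w s); rewrite ?expr1 ?expr0; field.
rewrite meanD meanD meanZ mean_cst ?card_signs_gt0// IH2.
set v := \sum_(_ <- _) _ in IH4 *; nra.
Qed.

(** A random variable cannot be small in [L_1] when its fourth moment is comparable
    to the square of its second one: integrate the pointwise inequality
    [6 sd^2 u^2 - u^4 <= 6 sd^3 u]. *)
Lemma khintchine_L1 (P : pred J) (y : J -> R) (a : R) :
  a ^+ 2 <= \sum_(s | P s) y s ^+ 2 ->
  a <= 2 * mean (fun w => `|\sum_(s | P s) (-1) ^+ w s * y s|).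
Proof.
move=> ha; set E := mean _.
have E0 : 0 <= E by exact: mean_ge0.
have [a0|a0] := leP a 0; first by rewrite (le_trans a0)// mulr_ge0.
pose v := \sum_(s | P s) y s ^+ 2.
have v0 : 0 < v by rewrite (lt_le_trans _ ha)// exprn_gt0.
pose sd := Num.sqrt v.
have sd0 : 0 < sd by rewrite sqrtr_gt0.
have sd2 : sd ^+ 2 = v by rewrite sqr_sqrtr// ltW.
have asd : a <= sd by rewrite -ler_sqr ?nnegrE ?sd2//; exact: ltW.
apply: (le_trans asd).
pose Z w := \sum_(s | P s) (-1) ^+ w s * y s.
have [m2 m4] : mean (fun w => Z w ^+ 2) = v /\ mean (fun w => Z w ^+ 4) <= 3 * v ^+ 2.
  have ve : \sum_(s <- enum P) y s ^+ 2 = v by rewrite big_enum.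
  have := khintchine_moments y (enum_uniq P); rewrite ve => -[m2 m4]; split.
    by rewrite -m2; apply: eq_mean => w; rewrite big_enum.
  by move: m4; under eq_mean do rewrite big_enum.
have key w : 6 * sd ^+ 2 * Z w ^+ 2 + (-1) * Z w ^+ 4 <= 6 * sd ^+ 3 * `|Z w|.
  rewrite -(real_normK (num_real (Z w))) -[4%N]/(2 * 2)%N exprM.
  rewrite -(real_normK (num_real (Z w))) -exprM.
  move: (normr_ge0 (Z w)); set u := `|Z w| => u0.
  (* The double root of [u^3 - 3 r^2 u + 2 r^3 = (u - r)^2 (u + 2 r)] is placed
     at [r = 1.42 sd], just above [sqrt 2 * sd], so that [3 r^2 >= 6 sd^2] and
     [2 r^3 <= 6 sd^3]. *)
  have h : 0 <= (u - 71 / 50 * sd) ^+ 2 * (u + 142 / 50 * sd).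
    by rewrite mulr_ge0 ?sqr_ge0// addr_ge0 ?mulr_ge0// ltW.
  have h2 : 0 <= u * (u - 71 / 50 * sd) ^+ 2 * (u + 142 / 50 * sd).
    by rewrite -mulrA mulr_ge0.
  have h3 : 0 <= sd ^+ 2 * u ^+ 2 by rewrite mulr_ge0 ?sqr_ge0.
  have h4 : 0 <= sd ^+ 3 * u by rewrite mulr_ge0 ?exprn_ge0// ltW.
  rewrite /=; nra.
have := le_mean key.
rewrite meanD !meanZ m2 -/E => h.
have h' : 6 * sd ^+ 2 * v - 3 * v ^+ 2 <= 6 * sd ^+ 3 * E by lra.
have h2 : sd ^+ 3 * (6 * E - 3 * sd) >= 0 by move: h'; rewrite -sd2; lra.
by move: h2; rewrite pmulr_rge0 ?exprn_gt0// => h2; lra.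
Qed.

End SignAverages.

(** * A lower bound for the maximum of many Rademacher sums *)

Section SignedRows.
Context {R : realType} {J : finType}.
Implicit Types (w : {ffun J -> bool}).

(** Flip all the signs of a row at once, independently for each row. In the sum
    tested against [x i], flipping row [i] alone changes the sign of the part
    carried by this row only, and [|a + b| + |- a + b| >= 2 |a|]. Averaging
    [M] over the row flips therefore bounds each part separately; as the
    maximum over [i] stays inside the average, one bound serves all rows. *)
Lemma discard_other_rows (m : nat) (row : J -> option 'I_m)
    (x : 'I_m -> J -> R) (M : {ffun J -> bool} -> R) :
  (forall w i, `|\sum_s (-1) ^+ w s * x i s| <= M w) ->
  exists2 N : {ffun J -> bool} -> R, mean N = mean M &
    forall w i, `|\sum_(s | row s == Some i) (-1) ^+ w s * x i s| <= N w.
Proof.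
move=> xM.
pose mask (h : {ffun 'I_m -> bool}) s := oapp h false (row s).
exists (fun w => mean (fun h => M (twist (mask h) w))).
  rewrite exchange_mean; under eq_mean do rewrite mean_twist.
  by rewrite mean_cst// card_signs_gt0.
move=> w i; set Y := \sum_(s | _) _.
rewrite -(mean_cst `|Y| (card_signs_gt0 'I_m)) [leRHS](mean_flip i).
apply: le_mean => h.
pose rest (h : {ffun 'I_m -> bool}) :=
  \sum_(s | row s != Some i) (-1) ^+ mask h s * (-1) ^+ w s * x i s.
have split_row h' : \sum_s (-1) ^+ twist (mask h') w s * x i s =
    (-1) ^+ h' i * Y + rest h'.
  rewrite (bigID (fun s => row s == Some i))/= /Y big_distrr/=.
  congr (_ + _); apply: eq_bigr => s rs; rewrite signr_twist//.
  by rewrite /mask (eqP rs)/= mulrA.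
have rest_flip : rest (twist (pred1 i) h) = rest h.
  apply: eq_bigr => s; rewrite /mask; case: (row s) => //= j ji.
  rewrite ffunE/=; case: eqP => [e|//].
  by rewrite e eqxx in ji.
have := xM (twist (mask h) w) i.
have := xM (twist (mask (twist (pred1 i) h)) w) i.
rewrite !split_row rest_flip signr_twist/= eqxx expr1 -mulrA mulN1r.
set b := rest h; set a := _ * Y => le1 le2.
have <- : `|a| = `|Y| by rewrite /a normrM normr_sign mul1r.
rewrite ler_pdivlMr//; apply: le_trans (lerD le2 le1).
rewrite -[2]ger0_norm// -normrM (_ : a * 2 = (a + b) - (- a + b)); last by ring.
exact: ler_normB.
Qed.

Lemma expn_pred_half (K : nat) : (0 < K -> 2 * K.-1 ^ K <= K ^ K)%N.
Proof.
case: K => // -[//|k] _ /=.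
have bernoulli n : (k.+1 ^ n + n * k.+1 ^ n.-1 <= k.+2 ^ n)%N.
  case: n => // n; elim: n => [|n IH]; first by rewrite !expn1 expn0; lia.
  rewrite expnS (expnS k.+2); move: IH; rewrite /= !expnS.
  set A := (k.+1 ^ n)%N; set B := (k.+2 ^ n)%N; nia.
have := bernoulli k.+2; apply: leq_trans.
by rewrite /= mul2n -addnn leq_add2l expnS leq_mul2r leqnSn orbT.
Qed.

(** Independent uniform rows of [g] signs, [2^g] of them, all miss a given pattern
    with probability [(1 - 2^-g)^(2^g) <= 1/2]. *)
Lemma aligned_row_often (g : nat) :
  (#|{ffun 'I_(2 ^ g) -> {ffun 'I_g -> bool}}|%:R : R) / 2 <=
  #|[pred d : {ffun 'I_(2 ^ g) -> {ffun 'I_g -> bool}} | [exists i, d i == [ffun=> false]]]|%:R.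
Proof.
pose patterns := {ffun 'I_(2 ^ g) -> {ffun 'I_g -> bool}}.
set A := [pred d : patterns | _].
pose z : {ffun 'I_g -> bool} := [ffun=> false].
have cA : #|[predC A]| = ((2 ^ g).-1 ^ (2 ^ g))%N.
  transitivity #|ffun_on (predC1 z) : {pred patterns}|.
    apply: eq_card => d; rewrite !inE; apply/negP/ffun_onP => [h i|h].
      by rewrite !inE; apply/negP => di; apply: h; apply/existsP; exists i.
    by move=> /existsP[i di]; have := h i; rewrite !inE di.
  by rewrite card_ffun_on cardC1 card_ffun card_bool !card_ord.
have cD : #|patterns| = ((2 ^ g) ^ (2 ^ g))%N.
  by rewrite !card_ffun card_bool !card_ord.
have e : (#|A| + #|[predC A]| = #|patterns|)%N := cardC A.
have h := @expn_pred_half (2 ^ g) (expn_gt0 2 g).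
rewrite ler_pdivrMr// -natrM ler_nat.
suff : (#|patterns| <= #|A| * 2)%N by [].
lia.
Qed.

(** Each row is cut into [g] colour classes, with partial sums [G i k]. Multiplying
    the signs of every class by an independent sign [d i k] changes nothing on
    average, and neither does correcting [d i k] by the sign of [G i k]. After the
    correction, a row [i] whose signs [d i k] are all [+1] has sum
    [sum_k |G i k|]. Since
    [d] is independent of [w], this row can be chosen first and [|G i k|]
    averaged afterwards. *)
Lemma mean_aligned_row (g : nat) (row : J -> option 'I_(2 ^ g)) (c : J -> 'I_g)
    (y : 'I_(2 ^ g) -> J -> R) (N : {ffun J -> bool} -> R) (e : R) :
  (forall w i, `|\sum_(s | row s == Some i) (-1) ^+ w s * y i s| <= N w) ->
  0 <= e ->
  (forall i k, e <= mean (fun w : {ffun J -> bool} =>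
     `|\sum_(s | (row s == Some i) && (c s == k)) (-1) ^+ w s * y i s|)) ->
  g%:R * e / 2 <= mean N.
Proof.
move=> yN e0 he.
pose D := {ffun 'I_(2 ^ g) -> {ffun 'I_g -> bool}}.
have D0 : (0 < #|D|)%N by apply/card_gt0P; exists [ffun=> [ffun=> false]].
pose G i k w := \sum_(s | (row s == Some i) && (c s == k)) (-1) ^+ w s * y i s.
have GE w i : \sum_(s | row s == Some i) (-1) ^+ w s * y i s = \sum_k G i k w.
  by rewrite (partition_big c predT).
pose mask (d : D) s := oapp (fun i => d i (c s)) false (row s).
(* The correcting pattern: the signs of the colour sums. *)
pose h w : D := [ffun i => [ffun k => G i k w < 0]].
pose shift (d' d : D) : D := [ffun i => [ffun k => d i k (+) d' i k]].
have shiftK d' : involutive (shift d').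
  by move=> d; apply/ffunP => i; apply/ffunP => k; rewrite !ffunE -addbA addbb addbF.
have N0 w : 0 <= N w.
  by apply: le_trans (normr_ge0 _) (yN w (Ordinal (expn_gt0 2 g))).
have Gtwist d w i k : G i k (twist (mask d) w) = (-1) ^+ d i k * G i k w.
  rewrite /G big_distrr/=; apply: eq_bigr => s /andP[/eqP rs /eqP cs].
  by rewrite signr_twist /mask rs/= cs mulrA.
pose N' (d : D) := mean (fun w => N (twist (mask (shift (h w) d)) w)).
have -> : mean N = mean N'.
  rewrite /N' exchange_mean.
  under [RHS]eq_mean => w do
    rewrite (mean_bij (fun d => N (twist (mask d) w)) (inv_bij (shiftK (h w)))).
  rewrite exchange_mean; under [RHS]eq_mean do rewrite mean_twist.
  by rewrite mean_cst.
have N'0 d : 0 <= N' d by exact: mean_ge0.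
have N'aligned (d : D) i : d i = [ffun=> false] -> g%:R * e <= N' d.
  move=> di; have -> : g%:R * e = \sum_(k < g) e.
    by rewrite sumr_const card_ord mulr_natl.
  apply: le_trans (_ : mean (fun w => \sum_(k < g) `|G i k w|) <= _).
    by rewrite mean_sum; apply: ler_sum => k _; exact: he.
  apply: le_mean => w; apply: le_trans (yN _ i).
  rewrite GE; under [in leRHS]eq_bigr => k _.
    rewrite Gtwist !ffunE di ffunE addFb.
    rewrite (_ : _ * _ = `|G i k w|); first over.
    case: ltrP => G0; first by rewrite expr1 mulN1r ltr0_norm.
    by rewrite expr0 mul1r ger0_norm.
  exact: ler_norm.
have half := aligned_row_often g.
rewrite /mean ler_pdivlMr ?ltr0n//.
pose A := [pred d : D | [exists i, d i == [ffun=> false]]].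
apply: le_trans (_ : \sum_(d in A) N' d <= _); last first.
  by rewrite [leRHS](bigID (mem A))/= lerDl sumr_ge0.
apply: le_trans (_ : \sum_(d in A) g%:R * e <= _); last first.
  by apply: ler_sum => d /existsP[i /eqP]; exact: N'aligned.
rewrite sumr_const -[_ *+ #|_|]mulr_natl.
have ge0 : 0 <= g%:R * e by rewrite mulr_ge0.
rewrite [leLHS](_ : _ = (#|D|%:R / 2) * (g%:R * e)); last by field.
exact: (ler_wpM2r ge0 half).
Qed.

End SignedRows.

(** * Few points exhaust the large entries of a block *)

Section Selection.
Context {R : realType} {J : finType}.

Lemma le_sum_sub (P Q : pred J) (F : J -> R) :
  (forall s, P s -> Q s) -> (forall s, 0 <= F s) ->
  \sum_(s | P s) F s <= \sum_(s | Q s) F s.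
Proof.
move=> PQ F0; rewrite [leRHS](bigID P)/=.
rewrite (eq_bigl P) ?lerDl ?sumr_ge0// => s.
by case Ps: (P s); rewrite ?andbF ?andbT// PQ.
Qed.

(** A minimal subset of weight at least [d] works: it loses this property when any
    element is removed. *)
Lemma subset_of_moderate_weight (A : {set J}) (v : J -> R) (d eta : R) :
  0 <= d -> 0 <= eta -> (forall s, s \in A -> v s <= eta) ->
  d <= \sum_(s in A) v s ->
  exists B : {set J}, [/\ B \subset A, d <= \sum_(s in B) v s &
                          \sum_(s in B) v s <= d + eta].
Proof.
move=> d0 eta0 veta dA.
pose P (B : {set J}) := (B \subset A) && (d <= \sum_(s in B) v s).
have PA : P A by rewrite /P subxx.
case: (arg_minnP (fun B : {set J} => #|B|) PA) => B /andP[BA dB] Bmin.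
exists B; split=> //.
have [->|[s sB]] := set_0Vmem B; first by rewrite big_set0 addr_ge0.
rewrite (big_setD1 s)//= addrC lerD ?veta ?(fintype.subsetP BA)//.
rewrite leNgt; apply/negP => dBs.
have /Bmin : P (B :\ s) by rewrite /P (fintype.subset_trans (finset.subsetDl _ _) BA) ltW.
by rewrite (cardsD1 s B) sB ltnn.
Qed.

(** The classes are split off one after the other, each using at most [d + eta]. *)
Lemma equitable_coloring (g : nat) (A : {set J}) (v : J -> R) (d eta : R) :
  (forall s, 0 <= v s) -> 0 <= d -> 0 <= eta ->
  (forall s, s \in A -> v s <= eta) ->
  g%:R * (d + eta) <= \sum_(s in A) v s ->
  exists c : J -> nat, forall k, (k < g)%N ->
    d <= \sum_(s in A | c s == k) v s.
Proof.
move=> v0 d0 eta0; elim: g A => [|g IH] A veta; first by exists (fun=> 0).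
rewrite -addn1 natrD mulrDl mul1r => gA.
have dA : d <= \sum_(s in A) v s.
  by apply: le_trans gA; rewrite -[leLHS]add0r lerD ?mulr_ge0 ?addr_ge0// lerDl.
have [B [BA dB Bd]] := subset_of_moderate_weight d0 eta0 veta dA.
have AB : \sum_(s in A) v s = \sum_(s in B) v s + \sum_(s in A :\: B) v s.
  rewrite (bigID (mem B))/=; congr (_ + _); apply: eq_bigl => s.
    by rewrite andbC; case sB: (s \in B) => //=; rewrite (fintype.subsetP BA).
  by rewrite finset.in_setD andbC.
have [||c cP] := IH (A :\: B).
- by move=> s; rewrite finset.in_setD => /andP[_]; exact: veta.
- by rewrite AB in gA; lra.
exists (fun s => if s \in B then g else c s) => k.
rewrite addn1 ltnS leq_eqVlt => /predU1P[->|kg].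
  apply: (le_trans dB); apply: le_sum_sub => // s sB.
  by rewrite sB (fintype.subsetP BA) /=.
apply: (le_trans (cP k kg)); apply: le_sum_sub => // s.
by rewrite finset.in_setD -andbA => /and3P[/negPf -> ->].
Qed.

(** The index [s] is used by the first point [t] of the list with [B s t], that is,
    by the point at position [find (B s) ts]; this is how the disjoint sets of
    used indices are encoded. The selection stops after [m] points, or when no
    point is left with weight [a] in the unused indices. *)
Lemma greedy_points (I : Type) (t0 : I) (B : J -> I -> bool) (v : J -> I -> R)
    (a : R) (m : nat) :
  exists ts : seq I, [/\ (size ts <= m)%N,
    forall i, (i < size ts)%N ->
      a <= \sum_(s | find (B s) ts == i) v s (nth t0 ts i) &
    size ts = m \/
    forall t, \sum_(s | ~~ has (B s) ts && B s t) v s t < a].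
Proof.
elim: m => [|m [ts [tsm ts_heavy ts_end]]]; first by exists [::]; split=> //; left.
have [ts_stop|next] := pselect
    (forall t, \sum_(s | ~~ has (B s) ts && B s t) v s t < a).
  by exists ts; split=> //; [exact: leqW|right].
have {ts_end}tsm' : size ts = m by case: ts_end.
have [t ht] : exists t, a <= \sum_(s | ~~ has (B s) ts && B s t) v s t.
  apply: contrapT => h; apply: next => t.
  by rewrite ltNge; apply/negP => ht; apply: h; exists t.
exists (rcons ts t); rewrite size_rcons tsm'; split=> //; last by left.
have find_rcons s : find (B s) (rcons ts t) =
    if has (B s) ts then find (B s) ts else (m + ~~ B s t)%N.
  by rewrite -cats1 find_cat/= tsm'; case: (B s t).
move=> i; rewrite ltnS leq_eqVlt => /predU1P[->|im].
  rewrite nth_rcons tsm' ltnn eqxx (eq_bigl (fun s => ~~ has (B s) ts && B s t))// => s.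
  rewrite find_rcons; case: ifPn => [|_]; first by rewrite has_find tsm' => /ltn_eqF.
  by case: (B s t); rewrite /= ?addn0 ?addn1 ?eqxx// eqn_leq ltnn.
rewrite nth_rcons tsm' im; have := ts_heavy i; rewrite tsm' => /(_ im).
rewrite (eq_bigl (fun s => find (B s) (rcons ts t) == i))// => s.
rewrite find_rcons; case: ifPn => // /hasNfind ->; rewrite tsm'.
by rewrite !gtn_eqF// (leq_trans im)// leq_addr.
Qed.

End Selection.

Section DyadicBlock.
Context {R : realType} {J : finType} {I : Type}.
Variables (x : J -> I -> R) (M : {ffun J -> bool} -> R).
Hypothesis xM : forall (w : {ffun J -> bool}) t, `|\sum_s (-1) ^+ w s * x s t| <= M w.
Hypothesis M1 : mean M <= 1.

Lemma sum_sqr_le4 t : \sum_s x s t ^+ 2 <= 4.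
Proof.
have v0 : 0 <= \sum_s x s t ^+ 2 by apply: sumr_ge0 => s _; exact: sqr_ge0.
have := @khintchine_L1 R J predT (x^~ t) (Num.sqrt (\sum_s x s t ^+ 2)).
rewrite sqr_sqrtr// => /(_ (lexx _)) h.
have {}h : Num.sqrt (\sum_s x s t ^+ 2) <= 2.
  apply: (le_trans h); rewrite -[leRHS]mulr1 ler_wpM2l//.
  by apply: le_trans M1; apply: le_mean => w; exact: xM.
rewrite -(sqr_sqrtr v0) (_ : 4 = 2 ^+ 2); last by rewrite expr2; lra.
by rewrite ler_sqr ?nnegrE// sqrtr_ge0.
Qed.

(** The rows have [n] colour classes of square sum at least [25 / n^2], because
    single squares are at most [1 / n^2]. By Khintchine each class has average
    modulus at least [5 / (2 n)], so the mean of [M] would be at least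
    [n * 5 / (2 n) / 2 = 5/4]. *)
Lemma no_full_selection (n : nat) (row : J -> option 'I_(2 ^ n))
    (tau : 'I_(2 ^ n) -> I) : (0 < n)%N ->
  (forall s i, row s = Some i -> `|x s (tau i)| <= n%:R^-1) ->
  (forall i, 26 / n%:R <= \sum_(s | row s == Some i) x s (tau i) ^+ 2) ->
  False.
Proof.
case: n row tau => // n row tau _; set k := n.+1 in row tau * => small heavy.
have k0 : (0 : R) < k%:R by rewrite ltr0n.
have [N NM xN] := @discard_other_rows R J _ row (fun i s => x s (tau i)) M
  (fun w i => xM w (tau i)).
have color i : exists c : J -> 'I_k, forall j : 'I_k,
    25 / k%:R ^+ 2 <= \sum_(s | (row s == Some i) && (c s == j)) x s (tau i) ^+ 2.
  have [|||||c cP] := @equitable_coloring R J k [set s | row s == Some i]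
    (fun s => x s (tau i) ^+ 2) (25 / k%:R ^+ 2) (k%:R^-1 ^+ 2).
  - by move=> s; exact: sqr_ge0.
  - by rewrite divr_ge0// exprn_ge0// ltW.
  - by rewrite sqr_ge0.
  - move=> s; rewrite inE => /eqP /small xs.
    by rewrite -(real_normK (num_real (x s _))) lerXn2r ?nnegrE// invr_ge0 ltW.
  - rewrite (eq_bigl (fun s => row s == Some i)); last by move=> s; rewrite inE.
    apply: le_trans (heavy i); rewrite le_eqVlt; apply/orP; left; apply/eqP.
    by field; rewrite gt_eqF.
  exists (fun s => inord (c s)) => j; apply: (le_trans (cP j (ltn_ord j))).
  apply: le_sum_sub => [s|s]; last exact: sqr_ge0.
  rewrite inE => /andP[-> /eqP ->] /=; apply/eqP/val_inj.
  by rewrite /= inordK.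
have [c cP] := boolp.choice color.
pose col s := if row s is Some i then c i s else ord0.
have := @mean_aligned_row R J k row col (fun i s => x s (tau i)) N (5 / 2 / k%:R) xN.
have -> : k%:R * (5 / 2 / k%:R) / 2 = 5 / 4 :> R by field; rewrite gt_eqF.
move=> NE; have {NE} : 5 / 4 <= mean N; first apply: NE => [|i j].
  by rewrite divr_ge0// ltW.
  have : (5 / k%:R) ^+ 2 <= \sum_(s | (row s == Some i) && (col s == j)) x s (tau i) ^+ 2.
    apply: le_trans (_ : 25 / k%:R ^+ 2 <= _).
      by rewrite le_eqVlt; apply/orP; left; apply/eqP; field; rewrite gt_eqF.
    apply: (le_trans (cP i j)); apply: le_sum_sub => [s|s]; last exact: sqr_ge0.
    by rewrite /col => /andP[/eqP -> ->]; rewrite eqxx.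
  by move=> /khintchine_L1 h; lra.
by rewrite NM => h; have := le_trans h M1; lra.
Qed.

(** The discarded set [U] consists of the indices used by a maximal greedy
    selection, which has at most [2^n] points. Each point [t] uses indices with
    [b s < 2^-n |x s t|], hence [sum b s ^ 2 <= 4 * 4^-n]. *)
Lemma block_light (t0 : I) (b : J -> R) (n : nat) : (0 < n)%N ->
  (forall s, 0 <= b s) ->
  exists U : J -> bool, \sum_(s | U s) b s ^+ 2 <= 4 / 2 ^+ n /\
    forall t, \sum_(s | ~~ U s && (2 ^+ n * b s < `|x s t| <= n%:R^-1)) x s t ^+ 2
              <= 26 / n%:R.
Proof.
move=> n0 b0.
pose B s t := 2 ^+ n * b s < `|x s t| <= n%:R^-1.
have [ts [tsn ts_heavy ts_end]] :=
  greedy_points t0 B (fun s t => x s t ^+ 2) (26 / n%:R) (2 ^ n).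
exists (fun s => has (B s) ts); split; last first.
  case: ts_end => [tsn'|light t]; last exact/ltW/light.
  exfalso.
  pose row s : option 'I_(2 ^ n) := insub (find (B s) ts).
  have rowE s i : (row s == Some i) = (find (B s) ts == i).
    rewrite /row; case: insubP => [j _ <-|]//=.
    by rewrite -leqNgt => h; rewrite gtn_eqF// (leq_trans (ltn_ord i) h).
  apply: (@no_full_selection n row (fun i => nth t0 ts i)) => //.
    move=> s i /eqP; rewrite rowE => /eqP e.
    have : has (B s) ts by rewrite has_find e tsn'.
    by move=> /(nth_find t0); rewrite e => /andP[].
  move=> i; rewrite (eq_bigl _ _ (rowE^~ i)).
  by apply: ts_heavy; rewrite tsn'.
have p0 : (0 : R) < 2 ^+ n by rewrite exprn_gt0.
apply: le_trans (_ : \sum_(t <- ts) \sum_(s | B s t) b s ^+ 2 <= _).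
  rewrite (exchange_big_dep predT)//= [leLHS]big_mkcond/=; apply: ler_sum => s _.
  have sum0 r : 0 <= \sum_(t <- r | B s t) b s ^+ 2.
    by apply: sumr_ge0 => t _; exact: sqr_ge0.
  case: ifPn => // has_s.
  have {has_s} : has (B s) ts by [].
  elim: (ts) => //= t r IH; rewrite big_cons; case: ifP => _ /= h; last exact: IH.
  by rewrite lerDl.
apply: le_trans (_ : \sum_(t <- ts) 4 / 2 ^+ n ^+ 2 <= _).
  apply: ler_sum => t _; rewrite ler_pdivlMr ?exprn_gt0// mulr_suml.
  apply: le_trans (sum_sqr_le4 t); rewrite big_mkcond/=; apply: ler_sum => s _.
  case: ifPn => [/andP[bx _]|_]; last exact: sqr_ge0.
  rewrite -exprMn mulrC -(real_normK (num_real (x s t))) lerXn2r ?nnegrE//.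
    by rewrite mulr_ge0 ?exprn_ge0.
  exact: ltW.
rewrite big_const_seq count_predT iter_addr_0 -[_ *+ size ts]mulr_natr.
have h : (size ts)%:R <= 2 ^+ n :> R by rewrite -natrX ler_nat.
rewrite [leRHS](_ : _ = 4 / 2 ^+ n ^+ 2 * 2 ^+ n); last by field; rewrite gt_eqF.
by rewrite ler_wpM2l// divr_ge0// !exprn_ge0.
Qed.

End DyadicBlock.

(** * Seminorms of a (2,1)-summing operator *)

Section SummingSeminorm.
Context {R : realType} {I : Type}.

(** The properties of [f |-> ||T f|| / C] when [C] is a (2,1)-summing bound for
    [T]: the weak [l_1] norm of a family of functions is the supremum of
    [sum_i |y_i(t)|]. *)
Record summing_seminorm (q : (I -> R) -> R) : Prop := SummingSeminorm {
  seminormD : forall f g, q (fun t => f t + g t) <= q f + q g;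
  seminormZ : forall a f, q (fun t => a * f t) = `|a| * q f;
  seminorm_summing : forall n (y : 'I_n -> I -> R),
    (forall t, \sum_i `|y i t| <= 1) -> \sum_i q (y i) ^+ 2 <= 1 }.

Variables (q : (I -> R) -> R) (qs : summing_seminorm q).

Lemma seminorm0 : q (fun=> 0) = 0.
Proof.
have <- : (fun _ : I => 0 * 0) = (fun=> 0) :> (I -> R).
  by apply/funext => t; rewrite mul0r.
by rewrite (seminormZ qs 0 (fun=> 0)) normr0 mul0r.
Qed.

Lemma seminorm_ge0 f : 0 <= q f.
Proof.
have := seminormD qs f (fun t => -1 * f t).
rewrite seminormZ// normrN1 mul1r (_ : (fun _ => _) = fun=> 0); last first.
  by apply/funext => t; rewrite mulN1r subrr.
by rewrite seminorm0 => h; lra.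
Qed.

Lemma le_seminorm_sum (K : Type) (r : seq K) (P : pred K) (F : K -> I -> R) :
  q (fun t => \sum_(k <- r | P k) F k t) <= \sum_(k <- r | P k) q (F k).
Proof.
elim: r => [|k r IH].
  rewrite big_nil (_ : (fun _ => _) = fun=> 0) ?seminorm0//.
  by apply/funext => t; rewrite big_nil.
rewrite big_cons; case: ifP => Pk.
  apply: le_trans (_ : q (F k) + q (fun t => \sum_(k <- r | P k) F k t) <= _).
    apply: le_trans (seminormD qs _ _); rewrite le_eqVlt; apply/orP; left.
    by apply/eqP; congr q; apply/funext => t; rewrite big_cons Pk.
  by rewrite lerD2l.
apply: le_trans IH; rewrite le_eqVlt; apply/orP; left.
by apply/eqP; congr q; apply/funext => t; rewrite big_cons Pk.
Qed.

(** The supremum of [sum_i q(y_i)^2] over admissible families may be approached but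
    not attained. If [|z| <= f <= 1], then [z] together with the functions
    [(1 - f) y_i] is again admissible, so it cannot beat [y] by more than
    [delta]. *)
Lemma near_extremal_family (delta : R) : 0 < delta ->
  exists n (y : 'I_n -> I -> R), (forall t, \sum_i `|y i t| <= 1) /\
    forall z f : I -> R, (forall t, `|z t| <= f t) -> (forall t, f t <= 1) ->
      q z ^+ 2 + \sum_i q (fun t => (1 - f t) * y i t) ^+ 2
      <= \sum_i q (y i) ^+ 2 + delta.
Proof.
move=> delta0.
pose A : set R := fun v => exists n (y : 'I_n -> I -> R),
  (forall t, \sum_i `|y i t| <= 1) /\ v = \sum_i q (y i) ^+ 2.
have supA : has_sup A.
  split; first by exists 0, 0%N, (fun _ _ => 0); split=> [t|]; rewrite big_ord0.
  by exists 1 => _ [n [y [y1 ->]]]; exact: (seminorm_summing qs).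
have [_ [n [y [y1 ->]]] near_sup] := sup_adherent delta0 supA.
exists n, y; split=> // z f zf f1.
(* The enlarged family has [z] at position [0]. *)
pose y' (i : 'I_n.+1) t :=
  if unlift ord0 i is Some j then (1 - f t) * y j t else z t.
have y'0 : y' ord0 = z by apply/funext => t; rewrite /y' unlift_none.
have y'S j : y' (lift ord0 j) = fun t => (1 - f t) * y j t.
  by apply/funext => t; rewrite /y' liftK.
have : A (\sum_i q (y' i) ^+ 2).
  exists n.+1, y'; split=> // t; rewrite big_ord_recl y'0.
  have f1t : 0 <= 1 - f t by rewrite subr_ge0.
  apply: le_trans (_ : f t + (1 - f t) * 1 <= _); last by lra.
  rewrite lerD//; apply: le_trans (ler_wpM2l f1t (y1 t)).
  rewrite mulr_sumr; apply: ler_sum => j _.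
  by rewrite y'S normrM (ger0_norm f1t).
move=> /(sup_upper_bound supA); rewrite big_ord_recl y'0.
under [X in _ + X]eq_bigr do rewrite y'S.
move=> h; move: near_sup; rewrite ltrBlDr => /ltW; exact: le_trans.
Qed.

(** Compare with a nearly extremal family [y]: making room for [z_k / a_k] in it,
    by the factors [1 - f_k] with [f_k = |z_k| / a_k], loses, up to
    [delta], at least what [z_k / a_k] brings. The loss is at most
    [2 sum_i q(y_i) (q(y_i) - q((1 - f_k) y_i))], and the average of these losses
    with the weights [a_k^2] is controlled by convexity of [q] through the single
    function [F = sum_k a_k |z_k| <= B]. This replaces the positive functional of
    the factorisation theorem for (2,1)-summing operators on spaces of
    continuous functions. *)
Lemma sum_sqr_seminorm_le (K : finType) (z : K -> I -> R) (a : K -> R) (B : R) :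
  0 < B -> (forall k, 0 <= a k) -> (forall k t, `|z k t| <= a k) ->
  (forall t, \sum_k a k * `|z k t| <= B) ->
  \sum_k q (z k) ^+ 2 <= 2 * B.
Proof.
move=> B0 a0 za zB; pose W := \sum_k a k ^+ 2.
have W0 : 0 <= W by apply: sumr_ge0 => k _; exact: sqr_ge0.
apply/ler_addgt0Pr => e e0; pose delta := e / (W + 1).
have W1 : 0 < W + 1 by lra.
have delta0 : 0 < delta by rewrite divr_gt0.
have [n [y [y1 ext]]] := near_extremal_family delta0.
pose f k t := (a k)^-1 * `|z k t|.
have af k t : a k * f k t = `|z k t|.
  rewrite /f; have [ak|ak] := eqVneq (a k) 0; last by rewrite mulVKf.
  by apply/eqP; rewrite ak mul0r eq_sym eq_le normr_ge0 -ak za.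
have f1 k t : f k t <= 1.
  have [ak|ak] := eqVneq (a k) 0; first by rewrite /f ak invr0 mul0r.
  by rewrite /f ler_pdivrMl ?mulr1// lt_def ak/=.
have aq k : a k ^+ 2 * q (fun t => (a k)^-1 * z k t) ^+ 2 = q (z k) ^+ 2.
  rewrite seminormZ// -exprMn mulrA; have [ak|ak] := eqVneq (a k) 0.
    rewrite ak mul0r mul0r (_ : z k = fun=> 0) ?seminorm0//.
    by apply/funext => t; apply/eqP; rewrite -normr_eq0 eq_le normr_ge0 -ak za.
  by rewrite ger0_norm ?invr_ge0// divff// mul1r.
pose v i := q (y i); pose F t := \sum_k a k * `|z k t|.
pose h i := q (fun t => F t * y i t).
pose u k i := q (fun t => (1 - f k t) * y i t).
have v0 i : 0 <= v i by exact: seminorm_ge0.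
have single k : q (z k) ^+ 2 <=
    delta * a k ^+ 2 + \sum_i 2 * v i * (a k ^+ 2 * v i - a k ^+ 2 * u k i).
  have zf t : `|(a k)^-1 * z k t| <= f k t by rewrite normrM ger0_norm// invr_ge0.
  have := ext _ _ zf (f1 k).
  rewrite -/(u k _) -aq => hk.
  have {}hk : q (fun t => (a k)^-1 * z k t) ^+ 2 <=
      delta + \sum_i (v i ^+ 2 - u k i ^+ 2).
    by rewrite sumrB; move: hk; rewrite /v /u; lra.
  apply: le_trans (ler_wpM2l (sqr_ge0 (a k)) hk) _.
  rewrite mulrDr mulrC lerD2l mulr_sumr; apply: ler_sum => i _.
  have : 0 <= a k ^+ 2 * (v i - u k i) ^+ 2 by rewrite mulr_ge0 ?sqr_ge0.
  lra.
have gain i : \sum_k (a k ^+ 2 * v i - a k ^+ 2 * u k i) <= h i.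
  rewrite sumrB -mulr_suml -/W lerBlDr.
  have -> : W * v i = q (fun t => W * y i t) by rewrite seminormZ// ger0_norm.
  have -> : (fun t => W * y i t) = (fun t => F t * y i t +
      \sum_k a k ^+ 2 * ((1 - f k t) * y i t)).
    apply/funext => t; rewrite /W /F !mulr_suml -big_split/=.
    by apply: eq_bigr => k _; rewrite -af; ring.
  apply: (le_trans (seminormD qs _ _)); rewrite lerD2l.
  apply: (le_trans (le_seminorm_sum _ _ _)); apply: ler_sum => k _.
  by rewrite seminormZ// ger0_norm ?sqr_ge0.
have Bi0 : 0 <= B^-1 by rewrite invr_ge0 ltW.
have h2 : \sum_i h i ^+ 2 <= B ^+ 2.
  have F0 t : 0 <= F t by apply: sumr_ge0 => k _; rewrite mulr_ge0.
  have yF t : \sum_i `|B^-1 * (F t * y i t)| <= 1.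
    apply: le_trans (y1 t); apply: ler_sum => i _.
    rewrite normrM (ger0_norm Bi0) normrM (ger0_norm (F0 t)).
    by rewrite ler_pdivrMl// ler_wpM2r ?zB.
  have := seminorm_summing qs yF.
  under eq_bigr do rewrite seminormZ// exprMn (ger0_norm Bi0) -/(h _).
  by rewrite -mulr_sumr exprVn ler_pdivrMl ?exprn_gt0// mulr1.
have v1 : \sum_i v i ^+ 2 <= 1 by exact: (seminorm_summing qs).
apply: le_trans (ler_sum _ (fun k _ => single k)) _.
rewrite big_split/= -mulr_sumr -/W [leLHS]addrC lerD//; last first.
  by rewrite /delta mulrAC ler_pdivrMr// ler_pM2l// lerDl.
rewrite exchange_big/=.
apply: le_trans (_ : \sum_i (B * v i ^+ 2 + B^-1 * h i ^+ 2) <= _).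
  apply: ler_sum => i _; rewrite -mulr_sumr.
  apply: le_trans (_ : 2 * v i * h i <= _); first by rewrite ler_wpM2l ?mulr_ge0.
  have : 0 <= B^-1 * (B * v i - h i) ^+ 2 by rewrite mulr_ge0 ?sqr_ge0.
  rewrite (_ : B^-1 * _ = B * v i ^+ 2 + B^-1 * h i ^+ 2 - 2 * v i * h i); first by lra.
  by field; rewrite gt_eqF.
rewrite big_split/= -!mulr_sumr mulrDl mul1r.
apply: lerD; first by rewrite ger_pMr.
by rewrite ler_pdivrMl// -expr2.
Qed.

End SummingSeminorm.

(** * The inequality for real families *)

Section RealCore.
Context {R : realType}.

Lemma sum_slabs (c : nat -> R) (u : R) (n : nat) :
  (forall i, c i <= c i.+1) ->
  \sum_(i < n) (c i < u <= c i.+1)%R%:R = (c 0%N < u <= c n)%R%:R :> R.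
Proof.
move=> cS; have c_ge i : c 0%N <= c i by elim: i => // i; move/le_trans; exact.
elim: n => [|n IH]; first by rewrite big_ord0; case: ltP => //= h; rewrite leNgt h.
rewrite big_ord_recr/= IH; have := c_ge n; have := cS n.
case: (ltP (c 0%N) u); case: (ltP (c n) u); case: (leP u (c n));
  case: (leP u (c n.+1)) => /=; rewrite ?addr0 ?add0r//; lra.
Qed.

Lemma sqr_sum_le (n : nat) (f : 'I_n -> R) :
  (\sum_i f i) ^+ 2 <= n%:R * \sum_i f i ^+ 2.
Proof.
elim: n f => [f|n IH f]; first by rewrite !big_ord0 expr0n mul0r.
rewrite !big_ord_recr/=; set a := f ord_max.
pose g i := f (widen_ord (leqnSn n) i); have := IH g; rewrite -/(g _).
set S := \sum_(i < n) _; set Q := \sum_(i < n) _ => SQ.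
have cross : 2 * S * a <= Q + n%:R * a ^+ 2.
  have : 0 <= \sum_(i < n) (g i - a) ^+ 2 by apply: sumr_ge0 => i _; exact: sqr_ge0.
  under eq_bigr do rewrite sqrrB.
  rewrite big_split/= sumrB sumr_const card_ord -/Q -mulr_natl.
  under [X in _ - X + _]eq_bigr do rewrite -mulrnAr.
  by rewrite -mulr_suml -/S -mulr_natr => h; lra.
by rewrite -natr1; lra.
Qed.

Context {I J : finType} (q : (I -> R) -> R) (qs : summing_seminorm q).
Variables (x : J -> I -> R) (M : {ffun J -> bool} -> R).
Hypothesis xM : forall (w : {ffun J -> bool}) t, `|\sum_s (-1) ^+ w s * x s t| <= M w.
Hypothesis M1 : mean M <= 1.

Definition cut (P : J -> I -> bool) (s : J) : I -> R :=
  fun t => (P s t)%:R * x s t.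

Lemma norm_cut P s t : `|cut P s t| = (P s t)%:R * `|x s t|.
Proof. by rewrite normrM ger0_norm. Qed.

Lemma cut_sum n (P : 'I_n -> J -> I -> bool) (Q : J -> I -> bool) s :
  (forall t, \sum_i (P i s t)%:R = (Q s t)%:R :> R) ->
  q (cut Q s) <= \sum_i q (cut (P i) s).
Proof.
move=> PQ; apply: le_trans (le_seminorm_sum qs _ _ _).
rewrite le_eqVlt; apply/orP; left; apply/eqP; congr q; apply/funext => t.
by rewrite /cut -mulr_suml PQ.
Qed.

(** Here [a i s * |x s t| <= 2 x s t ^ 2] wherever the [i]-th cut of [x s] lives. *)
Lemma dyadic_cuts n (P : 'I_n -> J -> I -> bool) (a : 'I_n -> J -> R) (D : R) :
  0 < D -> (forall i s, 0 <= a i s) ->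
  (forall i s t, P i s t -> `|x s t| <= a i s <= 2 * `|x s t|) ->
  (forall t, \sum_s (\sum_i (P i s t)%:R) * x s t ^+ 2 <= D) ->
  \sum_i \sum_s q (cut (P i) s) ^+ 2 <= 4 * D.
Proof.
move=> D0 a0 Pa PD.
rewrite (pair_bigA _ (fun i s => q (cut (P i) s) ^+ 2))/=.
have -> : 4 * D = 2 * (2 * D) by lra.
apply: (sum_sqr_seminorm_le qs (z := fun k => cut (P k.1) k.2)
  (a := fun k => a k.1 k.2)); first by lra.
- by move=> [i s] /=.
- move=> [i s] t /=; rewrite norm_cut; case Pi: (P i s t); rewrite ?mul0r//.
  by rewrite mul1r; have /andP[] := Pa _ _ _ Pi.
move=> t; rewrite -(pair_bigA _ (fun i s => a i s * `|cut (P i) s t|))/=.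
rewrite exchange_big/=.
apply: le_trans (_ : 2 * \sum_s (\sum_i (P i s t)%:R) * x s t ^+ 2 <= _); last first.
  by rewrite ler_wpM2l.
rewrite mulr_sumr; apply: ler_sum => s _; rewrite mulr_suml mulr_sumr.
apply: ler_sum => i _; rewrite norm_cut; case Pi: (P i s t); rewrite ?mul1r ?mul0r ?mulr0//.
have /andP[_ h] := Pa _ _ _ Pi.
by rewrite -(real_normK (num_real (x s t))) expr2 mulrA ler_wpM2r.
Qed.

Lemma layer_le (G : J -> bool) (m : nat) (i : nat) :
  \sum_s q (cut (fun s t => G s && (2 ^+ i / 2 ^+ m < `|x s t| <= 2 ^+ i.+1 / 2 ^+ m)) s) ^+ 2
  <= 16.
Proof.
pose P s t := G s && (2 ^+ i / 2 ^+ m < `|x s t| <= 2 ^+ i.+1 / 2 ^+ m).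
apply: le_trans (_ : \sum_(k < 1) \sum_s q (cut P s) ^+ 2 <= _).
  by rewrite big_ord1.
have -> : 16 = 4 * 4 :> R by lra.
apply: (@dyadic_cuts 1 (fun=> P) (fun _ _ => 2 ^+ i.+1 / 2 ^+ m)) => //.
- by move=> _ s t /and3P[_ lo hi] /=; rewrite hi exprS -mulrA ler_pM2l// ltW.
move=> t; apply: le_trans (sum_sqr_le4 xM M1 t); apply: ler_sum => s _.
by rewrite big_ord1 ler_piMl ?sqr_ge0//; case: (P s t).
Qed.

(** The block is a union of [n] dyadic slabs whose total contribution is at most
    [4 * 26 / n]; Cauchy-Schwarz over the slabs costs the factor [n]. *)
Lemma block_le (G : J -> bool) (S : J -> I -> bool) (b : J -> R) (n : nat) :
  (0 < n)%N -> (forall s, 0 <= b s) ->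
  (forall t, \sum_(s | [&& G s, S s t & 2 ^+ n * b s < `|x s t|]) x s t ^+ 2 <= 26 / n%:R) ->
  \sum_s q (cut (fun s t => [&& G s, S s t & 2 ^+ n * b s < `|x s t| <= 2 ^+ n.*2 * b s]) s) ^+ 2
  <= 104.
Proof.
move=> n0 b0 light.
pose P s t := [&& G s, S s t & 2 ^+ n * b s < `|x s t| <= 2 ^+ n.*2 * b s].
have n0' : (0 : R) < n%:R by rewrite ltr0n.
pose c s i := 2 ^+ (n + i) * b s.
have cS s i : c s i <= c s i.+1.
  by rewrite /c addnS exprS -mulrA ler_peMl ?mulr_ge0 ?exprn_ge0// ler1n.
pose Pi (i : 'I_n) s t := [&& G s, S s t & c s i < `|x s t| <= c s i.+1].
have PiP s t : \sum_i (Pi i s t)%:R = (P s t)%:R :> R.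
  rewrite /Pi /P; case: (G s); last by rewrite big1.
  case: (S s t); last by rewrite big1.
  by rewrite (sum_slabs _ _ (cS s)) /c addn0 addnn.
apply: le_trans (_ : n%:R * \sum_i \sum_s q (cut (Pi i) s) ^+ 2 <= _).
  rewrite exchange_big mulr_sumr/=; apply: ler_sum => s _.
  apply: le_trans (sqr_sum_le _).
  rewrite ler_sqr ?nnegrE ?seminorm_ge0//; last first.
    by apply: sumr_ge0 => i _; exact: seminorm_ge0.
  exact: cut_sum.
rewrite -ler_pdivlMl//.
have -> : n%:R^-1 * 104 = 4 * (26 / n%:R) :> R by field; rewrite gt_eqF.
apply: (@dyadic_cuts n Pi (fun i s => c s i.+1)).
- by rewrite divr_gt0.
- by move=> i s /=; rewrite mulr_ge0 ?exprn_ge0.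
- move=> i s t /and4P[_ _ lo hi] /=; rewrite hi /c addnS exprS -mulrA ler_pM2l//.
  exact: ltW.
move=> t; apply: le_trans (light t); rewrite [leRHS]big_mkcond/=.
apply: ler_sum => s _; rewrite PiP /P; case: (G s); case: (S s t) => /=; rewrite ?mul0r//.
case: ifP => _ /=; rewrite ?mul0r// ler_piMl ?sqr_ge0//.
by rewrite lern1 leq_b1.
Qed.

(** The bound involves the quantity to be estimated, but with a factor small enough
    to be absorbed: [2 b |x| <= b^2 / 12 + 12 x^2]. *)
Lemma bottom_le (G : J -> bool) (S : J -> I -> bool) (b : J -> R) :
  (forall s, 0 <= b s) ->
  \sum_s q (cut (fun s t => [&& G s, S s t & `|x s t| <= 2 * b s]) s) ^+ 2
  <= (\sum_(s | G s) b s ^+ 2) / 6 + 96.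
Proof.
move=> b0; pose P s t := [&& G s, S s t & `|x s t| <= 2 * b s]; set X := \sum_(s | G s) _.
have X0 : 0 <= X by apply: sumr_ge0 => s _; exact: sqr_ge0.
have -> : X / 6 + 96 = 2 * (X / 12 + 48) by lra.
apply: (sum_sqr_seminorm_le qs (a := fun s => 2 * b s)).
- by lra.
- by move=> s /=; rewrite mulr_ge0.
- move=> s t; rewrite norm_cut /P; case: (G s); case: (S s t) => /=; rewrite ?mul0r ?mulr_ge0//.
  by case: (leP `|x s t| (2 * b s)) => ?; rewrite /= ?mul1r ?mul0r ?mulr_ge0.
move=> t; have x4 := sum_sqr_le4 xM M1 t.
apply: le_trans (_ : X / 12 + 12 * \sum_s x s t ^+ 2 <= _); last by lra.
rewrite /X mulr_suml mulr_sumr [Y in _ <= Y + _]big_mkcond/= -big_split/=; apply: ler_sum => s _.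
rewrite norm_cut /P -(real_normK (num_real (x s t))).
have x0 := normr_ge0 (x s t); have bs := b0 s.
have sq : 0 <= (b s / 12 - `|x s t|) ^+ 2 by exact: sqr_ge0.
have x2 : 0 <= 12 * `|x s t| ^+ 2 by rewrite mulr_ge0 ?sqr_ge0.
case: (G s); rewrite /= ?mul0r ?mulr0 ?add0r//.
have le : 2 * b s * `|x s t| <= b s ^+ 2 / 12 + 12 * `|x s t| ^+ 2 by lra.
by case: (S s t && _); rewrite ?mul1r// mul0r mulr0 addr_ge0// divr_ge0// sqr_ge0.
Qed.

(** Indices for which [b s] is tiny compared with the sup norm of [x s] are few in
    the sense of square sums, because summing [x s t ^ 2] over all [t] costs only
    the factor [#|I|]. *)
Lemma oversize_le (b : J -> R) : (0 < #|I|)%N -> (forall s, 0 <= b s) ->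
  \sum_(s | [exists t, #|I|%:R * b s < `|x s t|]) b s ^+ 2 <= 4.
Proof.
move=> I0 b0; have I0' : (0 : R) < #|I|%:R by rewrite ltr0n.
apply: le_trans (_ : \sum_s \sum_t x s t ^+ 2 / #|I|%:R ^+ 2 <= _).
  rewrite big_mkcond; apply: ler_sum => s _.
  have x0 t : 0 <= x s t ^+ 2 / #|I|%:R ^+ 2 by rewrite divr_ge0 ?sqr_ge0.
  case: ifP => [/existsP[t ht]|_]; last by rewrite sumr_ge0.
  rewrite (bigD1 t)//= -[leLHS]addr0 lerD ?sumr_ge0//.
  rewrite ler_pdivlMr ?exprn_gt0// -exprMn mulrC -(real_normK (num_real (x s t))).
  by rewrite ler_sqr ?nnegrE ?mulr_ge0// ltW.
rewrite exchange_big/=.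
apply: le_trans (_ : \sum_(t : I) 4 / #|I|%:R ^+ 2 <= _).
  apply: ler_sum => t _; rewrite -mulr_suml ler_wpM2r ?invr_ge0 ?sqr_ge0//.
  exact: sum_sqr_le4.
rewrite sumr_const -[_ *+ #|_|]mulr_natr.
rewrite (_ : _ * _ = 4 / #|I|%:R); last by field; rewrite gt_eqF.
by rewrite ler_pdivrMr// ler_peMr// ler1n.
Qed.

(** With [X] the square sum over the indices kept, the triangle inequality over one
    bottom class, [m + 1] layers and [m] blocks gives
    [X <= 3 (X / 6 + 96 + 16 (m + 1)^2 + 104 m^2)], in which [X / 2] is absorbed.
    The discarded indices add at most [4 + 4 m]. *)
Lemma sum_sqr_le_loglog (m : nat) :
  (0 < m)%N -> (0 < #|I| <= 2 ^ (2 ^ m))%N ->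
  \sum_s q (x s) ^+ 2 <= (40 * m%:R) ^+ 2.
Proof.
move=> m0 /andP[I0 Im].
have [t0 _] : exists t0 : I, true by have /card_gt0P[t0] := I0; exists t0.
pose b s := q (x s).
have b0 s : 0 <= b s by exact: seminorm_ge0.
have [U UP] := boolp.choice (fun mu : nat =>
  block_light xM M1 t0 (expn_gt0 2 mu) b0).
pose big s := [exists t, #|I|%:R * b s < `|x s t|].
pose bad s := big s || [exists mu : 'I_m, U mu s].
pose G s := ~~ bad s.
have badP : \sum_(s | bad s) b s ^+ 2 <= 4 + 4 * m%:R.
  apply: le_trans (_ : \sum_(s | big s) b s ^+ 2 +
      \sum_(mu < m) \sum_(s | U mu s) b s ^+ 2 <= _).
    rewrite (exchange_big_dep predT)//= big_mkcond [X in X + _]big_mkcond -big_split/=.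
    apply: ler_sum => s _.
    have sum0 : 0 <= \sum_(mu < m | U mu s) b s ^+ 2.
      by apply: sumr_ge0 => mu _; exact: sqr_ge0.
    rewrite /bad; case: (big s) => /=; first by rewrite lerDl.
    rewrite add0r; case: ifP => // /existsP[mu Umu].
    by rewrite (bigD1 mu)//= lerDl sumr_ge0// => ? _; exact: sqr_ge0.
  rewrite lerD ?oversize_le//.
  apply: le_trans (_ : \sum_(mu < m) 4 <= _); last first.
    by rewrite sumr_const card_ord mulr_natr.
  apply: ler_sum => mu _; have [le _] := UP mu; apply: (le_trans le).
  by rewrite ler_pdivrMr ?exprn_gt0// ler_peMr// exprn_ege1// ler1n.
pose X := \sum_(s | G s) b s ^+ 2.
pose small s t := `|x s t| <= (2 ^+ m)^-1.
pose bottom s t := [&& G s, small s t & `|x s t| <= 2 * b s].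
pose layer i s t := G s && (2 ^+ i / 2 ^+ m < `|x s t| <= 2 ^+ i.+1 / 2 ^+ m).
pose block mu s t :=
  [&& G s, small s t & 2 ^+ (2 ^ mu) * b s < `|x s t| <= 2 ^+ (2 ^ mu).*2 * b s].
have p2 : (0 : R) < 2 ^+ m by rewrite exprn_gt0.
have bottomP : \sum_s q (cut bottom s) ^+ 2 <= X / 6 + 96 by exact: bottom_le.
have layerP i : \sum_s q (cut (layer i) s) ^+ 2 <= 16 by exact: layer_le.
have blockP mu : (mu < m)%N -> \sum_s q (cut (block mu) s) ^+ 2 <= 104.
  move=> mum; apply: block_le => //; first by rewrite expn_gt0.
  move=> t; have [_ /(_ t)] := UP mu; apply: le_trans.
  apply: le_sum_sub => [s|s]; last exact: sqr_ge0.
  move=> /and3P[Gs sm ->] /=; apply/andP; split.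
    move: Gs; rewrite /G /bad negb_or => /andP[_]; rewrite negb_exists.
    by move=> /forallP /(_ (Ordinal mum)).
  apply: (le_trans sm); rewrite lef_pV2 ?posrE ?ltr0n ?expn_gt0// -natrX ler_nat.
  by rewrite leq_exp2l// ltnW.
have decomp s : G s -> b s <= q (cut bottom s) +
    \sum_(i < m.+1) q (cut (layer i) s) + \sum_(mu < m) q (cut (block mu) s).
  move=> Gs.
  (* On a kept index every value is at most [2] and at most [2^(2^m) b_s], so the
     bottom class, the layers and the blocks split [x s] without overlap. *)
  pose mid s t := G s && ((2 ^+ m)^-1 < `|x s t| <= 2).
  pose low s t := [&& G s, small s t & 2 * b s < `|x s t| <= 2 ^+ (2 ^ m) * b s].
  have midP : q (cut mid s) <= \sum_(i < m.+1) q (cut (layer i) s).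
    apply: cut_sum => t; rewrite /mid /layer Gs/=.
    rewrite (sum_slabs (c := fun i => 2 ^+ i / 2 ^+ m))//.
      by rewrite expr0 mul1r exprS mulfK ?gt_eqF.
    by move=> i; rewrite ler_pM2r ?invr_gt0// exprS ler_peMl ?exprn_ge0// ler1n.
  have lowP : q (cut low s) <= \sum_(mu < m) q (cut (block mu) s).
    apply: cut_sum => t; rewrite /low /block Gs/=.
    case: (small s t) => /=; last by rewrite big1.
    under eq_bigr do rewrite -mul2n -expnS.
    rewrite (sum_slabs (c := fun mu => 2 ^+ (2 ^ mu) * b s))// => i.
    by rewrite ler_wpM2r// ler_eXn2l ?ltr1n// leq_exp2l.
  apply: le_trans (lerD (lerD (lexx _) midP) lowP).
  apply: le_trans (lerD (seminormD qs _ _) (lexx _)).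
  apply: le_trans (seminormD qs _ _).
  rewrite le_eqVlt; apply/orP; left; apply/eqP; congr q; apply/funext => t.
  rewrite /cut -!mulrDl /bottom /mid /low /small Gs/=.
  have x2 : `|x s t| <= 2.
    rewrite -ler_sqr ?nnegrE// real_normK ?num_real//.
    rewrite (_ : 2 ^+ 2 = 4); last by rewrite expr2; lra.
    apply: le_trans (sum_sqr_le4 xM M1 t).
    by rewrite (bigD1 s)//= lerDl sumr_ge0// => ? _; exact: sqr_ge0.
  have xb : `|x s t| <= 2 ^+ (2 ^ m) * b s.
    move: Gs; rewrite /G /bad negb_or => /andP[]; rewrite negb_exists.
    move=> /forallP /(_ t); rewrite -leNgt => h _; apply: (le_trans h).
    by rewrite ler_wpM2r// -natrX ler_nat.
  rewrite x2 xb !andbT.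
  by case: (leP `|x s t| (2 ^+ m)^-1); case: (leP `|x s t| (2 * b s));
    rewrite /= ?addr0 ?add0r mul1r.
have m1 : (1 : R) <= m%:R by rewrite ler1n.
have GX : X <= 3 * (X / 6 + 96 + m.+1%:R * (m.+1%:R * 16) + m%:R * (m%:R * 104)).
  apply: le_trans (_ : 3 * (\sum_s q (cut bottom s) ^+ 2 +
     m.+1%:R * (\sum_(i < m.+1) \sum_s q (cut (layer i) s) ^+ 2) +
     m%:R * (\sum_(mu < m) \sum_s q (cut (block mu) s) ^+ 2)) <= _); last first.
    rewrite ler_wpM2l// !lerD// ler_wpM2l//.
      apply: le_trans (_ : \sum_(i < m.+1) 16 <= _); first exact: ler_sum.
      by rewrite sumr_const card_ord mulr_natl.
    apply: le_trans (_ : \sum_(i < m) 104 <= _).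
      by apply: ler_sum => i _; exact: blockP.
    by rewrite sumr_const card_ord mulr_natl.
  rewrite exchange_big/= [X in _ + _ * X]exchange_big/= !mulr_sumr -!big_split/= mulr_sumr.
  rewrite /X big_mkcond; apply: ler_sum => s _.
  have sl := sqr_sum_le (fun i : 'I_m.+1 => q (cut (layer i) s)).
  have sb := sqr_sum_le (fun mu : 'I_m => q (cut (block mu) s)).
  set A := q (cut bottom s) in decomp *.
  have d := decomp s.
  set L := \sum_(i < _) q _ in sl d; set B := \sum_(i < _) q _ in sb d.
  set L2 := \sum_(i < m.+1) _ in sl *; set B2 := \sum_(i < m) _ in sb *.
  have three : (A + L + B) ^+ 2 <= 3 * (A ^+ 2 + m.+1%:R * L2 + m%:R * B2).
    have h1 : 0 <= (A - L) ^+ 2 by exact: sqr_ge0.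
    have h2 : 0 <= (A - B) ^+ 2 by exact: sqr_ge0.
    have h3 : 0 <= (L - B) ^+ 2 by exact: sqr_ge0.
    lra.
  case: ifP => Gs; last by apply: le_trans three; exact: sqr_ge0.
  apply: le_trans three; rewrite ler_sqr ?nnegrE ?b0//; first exact: d.
  exact: le_trans (b0 s) (d Gs).
have -> : \sum_s q (x s) ^+ 2 = \sum_(s | bad s) b s ^+ 2 + X.
  by rewrite (bigID bad).
move: GX badP; rewrite -natr1; set S := \sum_(s | bad s) _ => GX badP.
nra.
Qed.

End RealCore.

(** * The iterated logarithm *)

(** For the least such [m], [m - 1 < log2 (log2 N)]; and [log2 (log2 N) >= 1/2]
    because [N >= 3] yields [log2 N >= 3/2] from [3^2 >= 2^3]. *)
Lemma log2_log2_bounds (R : realType) (N : nat) : (3 <= N)%N ->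
  exists m : nat, [/\ (0 < m)%N, (N <= 2 ^ (2 ^ m))%N &
                      m%:R <= 3 * log2 (log2 N%:R : R)].
Proof.
move=> N3; have ex : exists m, (N <= 2 ^ (2 ^ m))%N.
  have lt2 k : (k < 2 ^ k)%N by exact: ltn_expl.
  by exists N; apply/ltnW/(ltn_trans (lt2 N))/lt2.
have ln2 : 0 < ln (2 : R) by rewrite ln_gt0// ltr1n.
have lnX (a : R) n : 0 < a -> ln (a ^+ n) = n%:R * ln a.
  by move=> a0; rewrite lnXn// mulr_natl.
have le_log2 (n k : nat) (a : R) : 0 < a -> 2 ^+ n <= a ^+ k ->
    n%:R <= k%:R * log2 a.
  move=> a0 nk; rewrite /log2 mulrA ler_pdivlMr// -!lnX//.
  by rewrite ler_ln ?posrE ?exprn_gt0.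
have N0 : (0 : R) < N%:R by rewrite ltr0n (leq_trans _ N3).
have N32 : 3 / 2 <= log2 (N%:R : R).
  have := le_log2 3 2 _ N0; rewrite -!natrX ler_nat => h.
  rewrite ler_pdivrMr// mulrC; apply: h.
  by apply: (@leq_trans (3 ^ 2)) => //; rewrite leq_exp2r.
have l0 : 0 < log2 (N%:R : R) by apply: lt_le_trans N32; lra.
have half : 1 / 2 <= log2 (log2 (N%:R : R)).
  have := le_log2 1 2 _ l0; rewrite expr1 => h.
  rewrite ler_pdivrMr// mulrC; apply: h.
  have : (3 / 2) ^+ 2 <= log2 (N%:R : R) ^+ 2.
    by rewrite ler_sqr ?nnegrE// (ltW l0).
  by lra.
case: (ex_minnP ex) => m Nm m_min; exists m; split=> //.
  by case: m Nm {m_min} => // /(leq_trans N3).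
case: m Nm m_min => [|m] Nm m_min; first by rewrite mulr_ge0//; lra.
have mN : (2 ^ (2 ^ m) < N)%N by rewrite ltnNge; apply/negP => /m_min; rewrite ltnn.
have h1 : 2 ^+ m <= log2 (N%:R : R).
  have := le_log2 (2 ^ m)%N 1 _ N0; rewrite mul1r natrX; apply.
  by rewrite expr1 -natrX ler_nat ltnW.
have := le_log2 m 1 _ l0; rewrite expr1 mul1r => /(_ h1).
by rewrite -natr1; lra.
Qed.

(** * From real families to both scalar fields *)

Section Transfer.
Context {R : realType} {K : numFieldType}.

(** A common description of the two scalar fields: [rho] embeds the reals and every
    scalar is [rho (p1 z) + iota * rho (p2 z)]. For the complex numbers [p1] and
    [p2] are the real and imaginary parts; for the reals [p2] and [iota] vanish. *)
Record real_coordinates (re : K -> R) (rho : {rmorphism R -> K})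
    (p1 p2 : K -> R) (iota : K) : Prop := RealCoordinates {
  reD : {morph re : x y / x + y};
  re_le : {homo re : x y / x <= y};
  re_scale : forall a z, re (rho a * z) = a * re z;
  re1 : re 1 = 1;
  norm_rho : forall a, `|rho a| = rho `|a|;
  p1D : {morph p1 : x y / x + y};
  p2D : {morph p2 : x y / x + y};
  p1_le : forall z, `|p1 z| <= re `|z|;
  p2_le : forall z, `|p2 z| <= re `|z|;
  iota_le1 : `|iota| <= 1;
  p1p2 : forall z, z = rho (p1 z) + iota * rho (p2 z) }.

Variables (re : K -> R) (rho : {rmorphism R -> K}) (p1 p2 : K -> R) (iota : K).
Hypothesis rc : real_coordinates re rho p1 p2 iota.

Lemma re0 : re 0 = 0.
Proof. by have := reD rc 0 0; rewrite addr0 => h; lra. Qed.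

Lemma re_sum J (r : seq J) (P : pred J) (F : J -> K) :
  re (\sum_(i <- r | P i) F i) = \sum_(i <- r | P i) re (F i).
Proof. exact: (big_morph re (reD rc) re0). Qed.

Lemma rnorm_ge0 (V : normedModType K) (v : V) : 0 <= rnorm re v.
Proof. by rewrite -re0; apply: (re_le rc). Qed.

Lemma rnormD (V : normedModType K) (u v : V) :
  rnorm re (u + v) <= rnorm re u + rnorm re v.
Proof. by rewrite /rnorm -(reD rc); apply: (re_le rc); exact: ler_normD. Qed.

Lemma rnormZ (V : normedModType K) (a : R) (v : V) :
  rnorm re (rho a *: v) = `|a| * rnorm re v.
Proof. by rewrite /rnorm normrZ (norm_rho rc) (re_scale rc). Qed.

Lemma entry_le_norm N (v : 'rV[K]_N) t : `|v 0 t| <= `|v|.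
Proof.
rewrite [leRHS]/Num.norm/= mx_normE -[leLHS]nngE num_le.
exact: (@le_bigmax _ _ _ _ (fun i : 'I_1 * 'I_N => `|v i.1 i.2|%:nng) (0, t)).
Qed.

Lemma norm_le1 N (v : 'rV[K]_N) : (forall t, `|v 0 t| <= 1) -> `|v| <= 1.
Proof.
move=> v1; rewrite [leLHS]/Num.norm/= mx_normE -[leRHS]nngE num_le.
apply/bigmax_leP; split=> [|[i t] _]; first by rewrite -num_le.
by rewrite -num_le/= ord1.
Qed.

Lemma phase (z : K) : exists2 theta : K, `|theta| <= 1 & `|z| = theta * z.
Proof.
have [->|z0] := eqVneq z 0; first by exists 0; rewrite ?normr0 ?mulr0.
exists (`|z| / z); last by rewrite divfK.
by rewrite normrM normfV normr_id divff// normr_eq0.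
Qed.

Lemma rho_le : {homo rho : a b / a <= b}.
Proof.
move=> a b ab; rewrite -subr_ge0 -rmorphB -(ger0_norm (_ : 0 <= b - a)) ?subr_ge0//.
by rewrite -(norm_rho rc).
Qed.

Definition embed N (f : 'I_N -> R) : 'rV[K]_N := \row_t rho (f t).

(** For a functional [xs] of norm at most [1] and suitable phases [theta_i],
    [sum_i |xs y_i| = xs (sum_i theta_i y_i)], and the entries of the argument are
    at most [sum_i |y_i(t)|] in modulus. *)
Lemma weak_l1_norm_embed_le1 N n (y : 'I_n -> 'I_N -> R) :
  (forall t, \sum_i `|y i t| <= 1) ->
  (weak_l1_norm re (fun i => embed (y i)) <= 1%:E)%E.
Proof.
move=> y1; apply: ge_ereal_sup => _ [xs xs1 <-]; rewrite lee_fin.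
rewrite -re_sum -(re1 rc); apply: (re_le rc).
have hphase i : exists theta : K,
    `|theta| <= 1 /\ `|xs (embed (y i))| = theta * xs (embed (y i)).
  by have [th h1 h2] := phase (xs (embed (y i))); exists th.
have [theta thetaP] := boolp.choice hphase.
rewrite -[leLHS]ger0_norm ?sumr_ge0//.
have -> : \sum_i `|xs (embed (y i))| = xs (\sum_i theta i *: embed (y i)).
  by rewrite linear_sum; apply: eq_bigr => i _; rewrite linearZ (thetaP i).2.
apply: le_trans (xs1 _) _; apply: norm_le1 => t.
rewrite summxE; apply: le_trans (ler_norm_sum _ _ _) _.
apply: le_trans (_ : rho (\sum_i `|y i t|) <= _); last first.
  by rewrite -(rmorph1 rho) rho_le.
rewrite rmorph_sum; apply: ler_sum => i _; rewrite !mxE normrM (norm_rho rc).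
rewrite ler_piMl ?(thetaP i).1// -(norm_rho rc); exact: normr_ge0.
Qed.

Definition operator_seminorm N (Y : normedModType K) (T : 'rV[K]_N -> Y) (C : R)
  (f : 'I_N -> R) : R := C^-1 * rnorm re (T (embed f)).

(** The bound [B] is enlarged to [C > 0], since the seminorm is normalised by [C]. *)
Lemma operator_summing_seminorm N (Y : normedModType K)
    (T : {linear 'rV[K]_N -> Y}) (B C : R) :
  0 <= B -> B <= C -> 0 < C -> summing21_bound re T B ->
  summing_seminorm (operator_seminorm T C).
Proof.
move=> B0 BC C0 TB; have Ci : 0 <= C^-1 by rewrite invr_ge0 ltW.
split=> [f g|a f|n y y1].
- rewrite /operator_seminorm -mulrDr ler_wpM2l//.
  apply: le_trans (rnormD _ _); rewrite -linearD le_eqVlt; apply/orP; left.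
  by apply/eqP; congr (rnorm re (T _)); apply/rowP => t; rewrite !mxE rmorphD.
- rewrite /operator_seminorm mulrCA -rnormZ -linearZ; congr (_ * rnorm re (T _)).
  by apply/rowP => t; rewrite !mxE rmorphM.
have := TB n (fun i => embed (y i)).
have weak1 := weak_l1_norm_embed_le1 y1.
move=> /le_trans /(_ (lee_wpmul2l _ weak1)); rewrite lee_fin => /(_ B0).
rewrite -EFinM lee_fin mulr1 => lB.
under eq_bigr do rewrite exprMn.
rewrite -mulr_sumr exprVn ler_pdivrMl ?exprn_gt0// mulr1.
have S0 : 0 <= \sum_i rnorm re (T (embed (y i))) ^+ 2.
  by apply: sumr_ge0 => i _; exact: sqr_ge0.
rewrite -(sqr_sqrtr S0) ler_sqr ?nnegrE ?sqrtr_ge0// ?(ltW C0)//.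
exact: le_trans lB BC.
Qed.

(** Applied to the real and to the imaginary part of the family; either part of the
    Rademacher sum is dominated by the norm of the whole sum. *)
Lemma coordinate_cotype N (Y : normedModType K) (T : {linear 'rV[K]_N -> Y})
    (p : K -> R) (B C r : R) (m S : nat) (x : 'I_S -> 'rV[K]_N) :
  {morph p : u v / u + v} -> (forall z, `|p z| <= re `|z|) ->
  (0 < m)%N -> (0 < N <= 2 ^ (2 ^ m))%N ->
  0 <= B -> B <= C -> 0 < C -> summing21_bound re T B ->
  0 < r -> Defs.expectation (fun w => rnorm re (\sum_s rademacher K s w *: x s)) <= r ->
  \sum_s rnorm re (T (embed (fun t => p (x s 0 t)))) ^+ 2 <= (40 * m%:R * C * r) ^+ 2.
Proof.
move=> pD p_le m0 Nm B0 BC C0 TB r0 xr.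
have qs := operator_summing_seminorm B0 BC C0 TB.
have p0 : p 0 = 0 by have := pD 0 0; rewrite addr0 => h; lra.
have pN z : p (- z) = - p z by have := pD z (- z); rewrite subrr p0 => h; lra.
pose M (w : {ffun 'I_S -> bool}) :=
  r^-1 * rnorm re (\sum_s rademacher K s w *: x s).
pose u s t := r^-1 * p (x s 0 t).
have ri : 0 <= r^-1 by rewrite invr_ge0 ltW.
have uM (w : {ffun 'I_S -> bool}) t : `|\sum_s (-1) ^+ w s * u s t| <= M w.
  under eq_bigr do rewrite mulrCA.
  rewrite -mulr_sumr normrM ger0_norm// ler_wpM2l//.
  have -> : \sum_s (-1) ^+ w s * p (x s 0 t) = p ((\sum_s rademacher K s w *: x s) 0 t).
    rewrite summxE (big_morph p pD p0); apply: eq_bigr => s _; rewrite !mxE.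
    rewrite /rademacher; case: (w s); rewrite ?expr0 ?mul1r// expr1.
    by rewrite !mulN1r pN.
  by apply: le_trans (p_le _) _; apply: (re_le rc); exact: entry_le_norm.
have M1 : mean M <= 1 by rewrite meanZ ler_pdivrMl// mulr1.
have := @sum_sqr_le_loglog R 'I_N 'I_S _ qs u M uM M1 m m0.
rewrite card_ord => /(_ Nm).
have -> : \sum_s operator_seminorm T C (u s) ^+ 2 =
    (C * r) ^- 2 * \sum_s rnorm re (T (embed (fun t => p (x s 0 t)))) ^+ 2.
  rewrite mulr_sumr; apply: eq_bigr => s _.
  rewrite /u (seminormZ qs) ger0_norm// /operator_seminorm mulrA -invfM.
  by rewrite exprMn exprVn [r * C]mulrC.
rewrite ler_pdivrMl ?exprn_gt0 ?mulr_gt0// => h.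
by apply: (le_trans h); rewrite le_eqVlt; apply/orP; left; apply/eqP; ring.
Qed.

(** Lets the summing constant and the average norm be taken positive, as the
    normalisations divide by them. *)
Lemma le_mul_of_le_perturbed (a A B C : R) : 0 <= A -> 0 <= B -> 0 <= C ->
  (forall d, 0 < d -> a <= A * (B + d) * (C + d)) -> a <= A * B * C.
Proof.
move=> A0 B0 C0 h; apply/ler_addgt0Pr => e e0.
pose D := A * (B + C + 1) + 1.
have D0 : 0 < D by rewrite ltr_wpDl// mulr_ge0// !addr_ge0.
pose d := Num.min 1 (e / D).
have d0 : 0 < d by rewrite lt_min ltr01 divr_gt0.
have d1 : d <= 1 by rewrite ge_min lexx.
have dD : d * D <= e by rewrite -ler_pdivlMr// ge_min lexx orbT.
apply: (le_trans (h d d0)).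
have h1 : 0 <= A * d * (1 - d) by rewrite !mulr_ge0 ?subr_ge0// ltW.
move: dD; rewrite /D => dD; nra.
Qed.

(** The constant [80 = 2 * 40] pays for the two real coordinates. *)
Lemma cotype2_bound_loglog N (Y : normedModType K) (T : {linear 'rV[K]_N -> Y})
    (B : R) (m : nat) :
  (0 < m)%N -> (0 < N <= 2 ^ (2 ^ m))%N -> 0 <= B -> summing21_bound re T B ->
  cotype2_bound re T (80 * m%:R * B).
Proof.
move=> m0 Nm B0 TB S x; set E := Defs.expectation _.
have E0 : 0 <= E by apply: mean_ge0 => w; exact: rnorm_ge0.
apply: le_mul_of_le_perturbed => // d d0.
have C0 : 0 < B + d by rewrite ltr_wpDl.
have r0 : 0 < E + d by rewrite ltr_wpDl.
have BC : B <= B + d by rewrite lerDl ltW.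
have Er : E <= E + d by rewrite lerDl ltW.
have h1 := coordinate_cotype (p1D rc) (p1_le rc) m0 Nm B0 BC C0 TB r0 Er.
have h2 := coordinate_cotype (p2D rc) (p2_le rc) m0 Nm B0 BC C0 TB r0 Er.
set V := _ ^+ 2 in h1 h2.
have K0 : 0 <= 80 * m%:R * (B + d) * (E + d) by rewrite !mulr_ge0// ltW.
rewrite /l2_norm_image -[leRHS]ger0_norm// -sqrtr_sqr ler_wsqrtr//.
apply: le_trans (_ : 4 * V <= _); last first.
  by rewrite le_eqVlt; apply/orP; left; apply/eqP; rewrite /V; ring.
have -> : 4 * V = 2 * V + 2 * V by ring.
apply: le_trans _ (lerD (ler_wpM2l _ h1) (ler_wpM2l _ h2)) => //.
rewrite !mulr_sumr -big_split/=; apply: ler_sum => s _.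
set u := embed _; set v := embed _.
have -> : x s = u + iota *: v.
  by apply/rowP => t; rewrite !mxE [LHS](p1p2 rc).
rewrite linearD linearZ.
have nv : rnorm re (iota *: T v) <= rnorm re (T v).
  by apply: (re_le rc); rewrite normrZ ler_piMl// (iota_le1 rc).
have le : rnorm re (T u + iota *: T v) <= rnorm re (T u) + rnorm re (T v).
  by apply: (le_trans (rnormD _ _)); rewrite lerD2l.
have n0 := rnorm_ge0 (T u + iota *: T v).
have nu0 := rnorm_ge0 (T u). have nv0 := rnorm_ge0 (T v).
have sq : 0 <= (rnorm re (T u) - rnorm re (T v)) ^+ 2 by exact: sqr_ge0.
apply: le_trans (_ : (rnorm re (T u) + rnorm re (T v)) ^+ 2 <= _); last by lra.
by rewrite ler_sqr ?nnegrE ?addr_ge0.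
Qed.

Lemma cotype2_le_loglog N (Y : normedModType K) (T : {linear 'rV[K]_N -> Y})
    (m : nat) (k : R) :
  (0 < m)%N -> (0 < N <= 2 ^ (2 ^ m))%N -> 0 < k -> 80 * m%:R <= k ->
  (cotype2 re T <= k%:E * summing21 re T)%E.
Proof.
move=> m0 Nm k0 mk; rewrite -lee_pdivrMl//; apply/ereal_infP => _ [B [B0 TB] <-].
rewrite lee_pdivrMl// -EFinM; apply: ereal_inf_lbound.
exists (k * B) => //; split; first by rewrite mulr_ge0// ltW.
move=> S x; apply: (le_trans (cotype2_bound_loglog m0 Nm B0 TB x)).
rewrite ler_wpM2r ?ler_wpM2r//.
by apply: mean_ge0 => w; exact: rnorm_ge0.
Qed.

End Transfer.

Lemma real_coordinates_real (R : realType) :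
  real_coordinates (id : R -> R) (idfun : {rmorphism R -> R}) id (fun=> 0) 0.
Proof.
split=> //=.
- by move=> x y; rewrite addr0.
- by move=> z; rewrite normr0.
- by rewrite normr0.
- by move=> z; rewrite mulr0 addr0.
Qed.

Lemma real_coordinates_complex (R : realType) :
  real_coordinates (@complex.Re R) (real_complex R : {rmorphism R -> R[i]})
    (@complex.Re R) (@complex.Im R) (Complex 0 1).
Proof.
have sqrt_le (a b : R) : `|a| <= Num.sqrt (a ^+ 2 + b ^+ 2).
  by rewrite -sqrtr_sqr ler_wsqrtr// lerDl sqr_ge0.
split=> //=.
- by move=> [a b] [c d].
- by move=> z w; rewrite lecE => /andP[].
- by move=> a [c d] /=; rewrite mul0r subr0.
- by move=> a; rewrite normc_def /= expr0n addr0 sqrtr_sqr.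
- by move=> [a b] [c d].
- by move=> [a b] [c d].
- by move=> [a b]; exact: sqrt_le.
- by move=> [a b] /=; rewrite addrC; exact: sqrt_le.
- by rewrite normc_def /= expr0n add0r expr1n sqrtr1.
- move=> [a b]; apply/eqP; rewrite eq_complex /=.
  by rewrite !(mul0r, mul1r, subr0, addr0, add0r) !eqxx.
Qed.

Theorem theorem2 (R : realType) :
  exists c : R, forall N : nat, (3 <= N)%N ->
    (forall (Y : completeNormedModType R) (T : {linear l_infty R N -> Y}),
       (cotype2 (id : R -> R) T
        <= (c * log2 (log2 N%:R))%:E * summing21 (id : R -> R) T)%E)
    /\
    (forall (Y : completeNormedModType R[i])
       (T : {linear l_infty R[i] N -> Y}),
       (cotype2 (@complex.Re R) T
        <= (c * log2 (log2 N%:R))%:E * summing21 (@complex.Re R) T)%E).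
Proof.
(* [240 = 3 * 80], as [m <= 3 log2 (log2 N)]. *)
exists 240 => N N3; have [m [m0 Nm ml]] := log2_log2_bounds R N3.
have Nm' : (0 < N <= 2 ^ (2 ^ m))%N by rewrite Nm (leq_trans _ N3).
have m1 : (1 : R) <= m%:R by rewrite ler1n.
have k0 : 0 < 240 * log2 (log2 N%:R : R) by lra.
have mk : 80 * m%:R <= 240 * log2 (log2 N%:R : R) by lra.
split=> Y T.
- exact: (cotype2_le_loglog (real_coordinates_real R) T m0 Nm' k0 mk).
- exact: (cotype2_le_loglog (real_coordinates_complex R) T m0 Nm' k0 mk).
Qed.
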